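(* Let $(T,v_0,\alpha)$ be a plane rooted tree with weight function $\alpha$, let $(T',v',\alpha')$ be a splitting subtree of $(T,v_0,\alpha)$, and let $(T'',v_0,\alpha'')$ be the complementary tree for $(T',v',\alpha')$. Then $$Q_q(T,v_0,\alpha)=Q_q(T',v',\alpha')\cdot Q_q(T'',v_0,\alpha'').$$
   Context: A plane rooted tree $(T,v_0)$ is a finite tree with root $v_0$ drawn in the plane growing upward from the root, i.e. the children of each vertex are linearly ordered from left to right. A leaf is a non-root vertex of degree 1; $L(T)$ is the set of leaves and $V(T)$ the set of vertices. A weight function is a map $\alpha:L(T)\to\mathbb{N}=\{1,2,\dots\}$, and $L_1(T)=\{v\in L(T):\alpha(v)=1\}$. Plucking polynomial: $Q_q(T,v_0,\alpha)=1$ if $T$ has no edges, and otherwise $$Q_q(T,v_0,\alpha)=\sum_{v\in L_1(T)}q^{r(T,v_0,v)}\,Q_q(T-v,v_0,\alpha_v),$$ where $r(T,v_0,v)$ is the number of vertices of $T$ to the right of the unique path from $v_0$ to $v$ (vertices not on the path which branch off from it to the right), and $\alpha_v(u)=\max\{1,\alpha(u)-1\}$ if $u$ is a leaf of $T$, $\alpha_v(u)=1$ if $u$ is a new leaf of $T-v$. For $v\in V(T)$, $T_v$ is the subtree of $T$ above $v$: the plane subtree rooted at $v$ induced by all vertices $u$ whose simple path to $v_0$ passes through $v$. The ordered rooted sum $T_1\vee T_2$ of plane rooted trees is obtained by identifying their roots, with $T_1$ placed to the left of $T_2$. Splitting subtree: $(T',v',\alpha')$ is a splitting subtree of $(T,v_0,\alpha)$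 if (i) $v'\in V(T)$, $T_{v'}=T_l\vee T'\vee T_r$ for some trees $T_l,T_r$ (all rooted at $v'$), and $\alpha'$ is the restriction of $\alpha$ to $L(T')$; and (ii) $\alpha'(v)\le\alpha(u)$ for all $v\in L(T')$ and $u\in L(T)\setminus L(T')$. Complementary tree: let $P_k$ be the plane rooted path with $k=|V(T')|-1$ edges, rooted at one of its end vertices. The complementary tree $(T'',v_0,\alpha'')$ for $(T',v',\alpha')$ is obtained from $T$ by replacing $T_{v'}=T_l\vee T'\vee T_r$ by $T_l\vee P_k\vee T_r$, with $\alpha''(v)=\alpha(v)$ if $v\in L(T'')\cap L(T)$ and $\alpha''(v)=1$ if $v\in L(T'')\setminus L(T)$. *)

(* Defs.v *)
From mathcomp Require Import all_boot all_order all_algebra.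
From mathcomp Require Import zify.

Set Implicit Arguments.
Unset Strict Implicit.
Unset Printing Implicit Defensive.

Import GRing.Theory.
Local Open Scope ring_scope.

(* A vertex is given by its name in V together with the left-to-right list of
   the subtrees above its children.  A term stands for a plane rooted tree
   exactly when its names are pairwise distinct, i.e. [uniq (vertices T)]; the
   root of T is part of T, so it is not repeated as a separate argument. *)
Inductive ptree (V : Type) : Type := Node of V & seq (ptree V).

Definition root_of (V : Type) (T : ptree V) : V := let: Node v _ := T in v.

Definition children (V : Type) (T : ptree V) : seq (ptree V) :=
  let: Node _ ts := T in ts.

Fixpoint subtrees (V : Type) (T : ptree V) : seq (ptree V) :=
  let: Node _ ts := T in T :: flatten (map (@subtrees V) ts).

Definition vertices (V : Type) (T : ptree V) : seq V :=
  map (@root_of V) (subtrees T).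

Definition num_edges (V : Type) (T : ptree V) : nat := (size (vertices T)).-1.

(* T_v, for v a vertex of T; the one-vertex tree if v is not a vertex of T. *)
Definition subtree (V : eqType) (T : ptree V) (v : V) : ptree V :=
  head (Node v [::]) [seq t <- subtrees T | root_of t == v].

(* One edge towards each child, and one towards the parent if there is one. *)
Definition degree (V : eqType) (T : ptree V) (v : V) : nat :=
  (size (children (subtree T v)) + (v != root_of T))%N.

Definition leaves (V : eqType) (T : ptree V) : seq V :=
  [seq v <- vertices T | (v != root_of T) && (degree T v == 1%N)].

(* A weight function on L(T) is represented by a function on all names, of
   which only the values on the leaves of T are ever used. *)
Definition weight_function (V : eqType) (T : ptree V) (alpha : V -> nat) : Prop :=
  {in leaves T, forall v, (0 < alpha v)%N}.

Definition leaves1 (V : eqType) (T : ptree V) (alpha : V -> nat) : seq V :=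
  [seq v <- leaves T | alpha v == 1%N].

(* The vertices to the right of the path from the root of T to v: at each
   vertex of the path, the vertices above the children that follow (in the
   left-to-right order) the child through which the path continues. *)
Fixpoint right_of (V : eqType) (v : V) (T : ptree V) : seq V :=
  let: Node _ ts := T in
  (fix scan (s : seq (ptree V)) : seq V :=
     if s is t :: s' then
       if v \in vertices t then right_of v t ++ flatten (map (@vertices V) s')
       else scan s'
     else [::]) ts.

Definition right_number (V : eqType) (T : ptree V) (v : V) : nat :=
  size (right_of v T).

(* T - v for a leaf v. *)
Fixpoint delete_leaf (V : eqType) (v : V) (T : ptree V) : ptree V :=
  let: Node u ts := T in
  Node u [seq t <- map (delete_leaf v) ts | root_of t != v].

Definition plucked_weight (V : eqType) (T : ptree V) (alpha : V -> nat) (u : V) : nat :=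
  if u \in leaves T then maxn 1 (alpha u).-1 else 1%N.

(* The counter n only makes the recursion structural: plucking_polyE shows that
   the number of edges suffices. *)
Fixpoint plucking_rec (V : eqType) (n : nat) (T : ptree V) (alpha : V -> nat) :
    {poly int} :=
  if num_edges T == 0%N then 1
  else if n is n'.+1 then
    \sum_(v <- leaves1 T alpha)
       'X^(right_number T v)
       * plucking_rec n' (delete_leaf v T) (plucked_weight T alpha)
  else 0.

Definition plucking_poly (V : eqType) (T : ptree V) (alpha : V -> nat) : {poly int} :=
  plucking_rec (num_edges T) T alpha.

(* The ordered sum (join) of T1 and T2, meant for T1 and T2 with the same root. *)
Definition rooted_sum (V : Type) (T1 T2 : ptree V) : ptree V :=
  Node (root_of T1) (children T1 ++ children T2).

Fixpoint replace_subtree (V : eqType) (v : V) (S T : ptree V) : ptree V :=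
  let: Node u ts := T in
  if u == v then S else Node u (map (replace_subtree v S) ts).

(* The path with size s edges whose vertices are, from its root up, v :: s. *)
Fixpoint path_tree (V : Type) (v : V) (s : seq V) : ptree V :=
  Node v (if s is x :: s' then [:: path_tree x s'] else [::]).

Definition sum_decomposition (V : eqType) (T T' Tl Tr : ptree V) : Prop :=
  [/\ root_of Tl = root_of T', root_of Tr = root_of T' &
      subtree T (root_of T') = rooted_sum (rooted_sum Tl T') Tr].

Definition splitting_subtree (V : eqType) (T : ptree V) (alpha : V -> nat)
    (T' : ptree V) (alpha' : V -> nat) : Prop :=
  [/\ root_of T' \in vertices T,
      exists Tl Tr : ptree V, sum_decomposition T T' Tl Tr,
      {in leaves T', alpha' =1 alpha} &
      forall v u : V, v \in leaves T' -> u \in leaves T -> u \notin leaves T' ->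
        (alpha' v <= alpha u)%N].

(* The non-root vertices s of the path P_k are new, i.e. not vertices of T. *)
Definition complementary_tree (V : eqType) (T : ptree V) (alpha : V -> nat)
    (T' T'' : ptree V) (alpha'' : V -> nat) : Prop :=
  exists (Tl Tr : ptree V) (s : seq V),
    [/\ sum_decomposition T T' Tl Tr,
        [/\ size s = (size (vertices T')).-1, uniq s &
            {in s, forall x, x \notin vertices T}],
        T'' = replace_subtree (root_of T')
                (rooted_sum (rooted_sum Tl (path_tree (root_of T') s)) Tr) T &
        {in leaves T'', forall v,
           alpha'' v = if v \in leaves T then alpha v else 1%N}].

Lemma ptree_nested_ind (V : Type) (P : ptree V -> Prop) :
  (forall v ts, foldr (fun t => and (P t)) True ts -> P (Node v ts)) ->
  forall T, P T.
Proof.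
move=> IH; fix rec 1 => -[v ts]; apply: IH.
by elim: ts => //=.
Qed.

Lemma vertices_Node (V : Type) (v : V) (ts : seq (ptree V)) :
  vertices (Node v ts) = v :: flatten (map (@vertices V) ts).
Proof. by rewrite /vertices /= map_flatten -map_comp. Qed.

Lemma root_delete_leaf (V : eqType) (v : V) (T : ptree V) :
  root_of (delete_leaf v T) = root_of T.
Proof. by case: T. Qed.

Lemma size_delete_leaf (V : eqType) (v : V) (T : ptree V) :
  (size (vertices (delete_leaf v T)) + (v \in behead (vertices T))
     <= size (vertices T))%N.
Proof.
elim/ptree_nested_ind: T => u ts IH.
have consE x (s1 s2 : seq V) (b : bool) :
  (size (x :: s1) + b <= size (x :: s2))%N = (size s1 + b <= size s2)%N by [].
rewrite [delete_leaf _ _]/= !vertices_Node [behead _]/= consE.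
elim: ts IH => //= t ts IHts [IHt /IHts{IHts}].
have vertE (T : ptree V) : vertices T = root_of T :: behead (vertices T).
  by case: T => w ws; rewrite vertices_Node.
rewrite root_delete_leaf mem_cat size_cat => IHts.
have: ((v \in vertices t) <= (root_of t == v) + (v \in behead (vertices t)))%N.
  by rewrite {1}(vertE t) inE eq_sym; case: eqP; case: (v \in behead _).
have: (0 < size (vertices t))%N by rewrite (vertE t).
case: eqP => _ /=; rewrite ?size_cat; move: IHt IHts;
  case: (v \in vertices t); case: (v \in behead _); case: (v \in flatten _) => /=;
  lia.
Qed.

Lemma num_edges_delete_leaf (V : eqType) (v : V) (T : ptree V) :
  v \in leaves T -> (num_edges (delete_leaf v T) < num_edges T)%N.
Proof.
rewrite mem_filter => /andP[/andP[v_root _] vT].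
have v_behead : v \in behead (vertices T).
  by case: T v_root vT => u ts /negPf v_root; rewrite !vertices_Node inE v_root.
have size_gt0 S : (0 < size (@vertices V S))%N by case: S => u ts; rewrite vertices_Node.
move: (size_delete_leaf v T) (size_gt0 (delete_leaf v T)).
by rewrite /num_edges v_behead; lia.
Qed.

Lemma plucking_polyE (V : eqType) (T : ptree V) (alpha : V -> nat) :
  plucking_poly T alpha =
  if num_edges T == 0%N then 1
  else \sum_(v <- leaves1 T alpha)
         'X^(right_number T v)
         * plucking_poly (delete_leaf v T) (plucked_weight T alpha).
Proof.
have enough n m (S : ptree V) beta : (num_edges S <= n)%N -> (num_edges S <= m)%N ->
    plucking_rec n S beta = plucking_rec m S beta.
  elim: n m S beta => [|n IHn] [|m] S beta /=; case: eqP => //; try by lia.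
  move=> _ leSn leSm; apply: eq_big_seq => v.
  rewrite mem_filter => /andP[_ /num_edges_delete_leaf ltv].
  by congr (_ * _); apply: IHn; rewrite -ltnS; apply: leq_trans ltv _.
rewrite /plucking_poly; case DT: (num_edges T) => [|n] /=; rewrite DT //=.
apply: eq_big_seq => v; rewrite mem_filter => /andP[_ /num_edges_delete_leaf].
by rewrite DT ltnS => lev; congr (_ * _); apply: enough.
Qed.

(* Main.v *)
Require Import Defs.
From mathcomp Require Import all_boot all_order all_algebra.
From mathcomp Require Import zify.
Set Implicit Arguments.
Unset Strict Implicit.
Unset Printing Implicit Defensive.

Import GRing.Theory.
Local Open Scope ring_scope.

(** Pluck the leaves of T one at a time and follow the part F that lies above
    v' in T' (a run of consecutive subtrees).  The rest of T is a context C with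
    a hole, T = C[F], and T'' = C[P] with P a path having as many vertices as F.
    A plucked leaf belongs to F or to C.

    If it belongs to F, its exponent is the one it has in F plus the number of
    vertices of C right of the hole, and that number is also the exponent of the
    top of P in C[P]: this pluck is one of F together with one of C[P].

    If it belongs to C, its exponent and the effect on C depend on F only
    through the number of vertices of F, which P shares: this pluck is one of
    C[P] alone.  It occurs only when a leaf of C has weight 1; as the weights of
    F are bounded by those of the leaves of C, they are then all 1, and the
    ageing of the weights that follows the pluck does not change F.

    Expand Q(C[P]) in Q(F) * Q(C[P]) by the recurrence, and expand Q(F) as well
    in the term that plucks the top of P: these are the two groups of terms of
    Q(C[F]), up to induction on the number of vertices ([forest_poly_plug]).

    The argument never uses the names of the vertices, so it is carried out on
    forests whose vertices carry only weights.  Giving weight 1 to every inner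
    vertex makes the rule for new leaves automatic, since an inner vertex
    becomes a leaf with weight 1 and ageing fixes 1.  Distinctness of the names
    only serves to show that this translation computes the plucking polynomial
    ([plucking_poly_weigh]) and that the subtree and its replacement are two
    fillings of the same context ([tree_context]). *)

(** * Vertices and leaves of forests *)

Notation forest V := (seq (ptree V)).

(** A forest is a binary tree in disguise (subtrees above the root of the first
    tree, remaining trees); inducting along this view avoids all nesting. *)
Lemma forest_ind (V : Type) (P : forest V -> Prop) :
  P [::] -> (forall v ts F, P ts -> P F -> P (Node v ts :: F)) ->
  forall F, P F.
Proof.
move=> P0 PS; have H T : forall F, P F -> P (T :: F).
  elim/ptree_nested_ind: T => v ts IH F PF; apply: PS => //.
  by elim: ts IH => //= t ts IHts [Pt /IHts]; apply: Pt.
by elim=> // t F PF; apply: H.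
Qed.

Definition forest_vertices (V : Type) (F : forest V) : seq V :=
  flatten (map (@vertices V) F).

Fixpoint tree_leaves (V : Type) (T : ptree V) : seq V :=
  let: Node v ts := T in
  if ts is [::] then [:: v] else flatten (map (@tree_leaves V) ts).

Definition forest_leaves (V : Type) (F : forest V) : seq V :=
  flatten (map (@tree_leaves V) F).

Lemma forest_vertices_cons (V : Type) v (ts F : forest V) :
  forest_vertices (Node v ts :: F) = v :: forest_vertices ts ++ forest_vertices F.
Proof. by rewrite -[LHS]/(vertices (Node v ts) ++ _) vertices_Node. Qed.

Lemma forest_vertices_gt0 (V : Type) (F : forest V) :
  F <> [::] -> (0 < size (forest_vertices F))%N.
Proof. by case: F => // -[v ts] F _; rewrite forest_vertices_cons. Qed.

Lemma forest_vertices_cat (V : Type) (F G : forest V) :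
  forest_vertices (F ++ G) = forest_vertices F ++ forest_vertices G.
Proof. by rewrite /forest_vertices map_cat flatten_cat. Qed.

Lemma forest_leaves_cons (V : Type) v (ts F : forest V) :
  forest_leaves (Node v ts :: F) =
    (if ts is [::] then [:: v] else forest_leaves ts) ++ forest_leaves F.
Proof. by []. Qed.

Lemma forest_leaves_cat (V : Type) (F G : forest V) :
  forest_leaves (F ++ G) = forest_leaves F ++ forest_leaves G.
Proof. by rewrite /forest_leaves map_cat flatten_cat. Qed.

Lemma verticesE (V : Type) (T : ptree V) :
  vertices T = map (@root_of V) (subtrees T).
Proof. by []. Qed.

Lemma forest_verticesE (V : Type) (F : forest V) :
  forest_vertices F = flatten (map (@vertices V) F).
Proof. by []. Qed.

(* Simplification and unification would unfold these into flattened lists that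
   the equations above no longer match. *)
#[local] Opaque vertices forest_vertices forest_leaves.

Lemma forest_leaves_sub (V : eqType) (F : forest V) :
  {subset forest_leaves F <= forest_vertices F}.
Proof.
elim/forest_ind: F => // v ts F IHts IHF u.
rewrite forest_leaves_cons forest_vertices_cons inE !mem_cat.
case: ts IHts => [|t ts] IHts.
  by rewrite inE => /orP[->//|/IHF->]; rewrite !orbT.
by case/orP => [/IHts->|/IHF->]; rewrite !orbT.
Qed.

(** * Plucking weighted forests *)

Fixpoint map_tree (A B : Type) (f : A -> B) (T : ptree A) : ptree B :=
  let: Node a ts := T in Node (f a) (map (map_tree f) ts).

Definition age_weight (a : nat) : nat := maxn 1 a.-1.

Definition age (F : forest nat) : forest nat := map (map_tree age_weight) F.

(** A pluck of a forest F is a pair (exponent, what is left of F).  The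
    recursion on trees is a parameter so that trees and forests, which are
    nested, can share this scan. *)
Definition plucks_with (pluck_tree : ptree nat -> seq (nat * forest nat)) :=
  fix scan (F : forest nat) : seq (nat * forest nat) :=
    if F is t :: F' then
      [seq ((p.1 + size (forest_vertices F'))%N, p.2 ++ F') | p <- pluck_tree t]
      ++ [seq (p.1, t :: p.2) | p <- scan F']
    else [::].

Fixpoint tree_plucks (T : ptree nat) : seq (nat * forest nat) :=
  let: Node a ts := T in
  if ts is [::] then nseq (a == 1%N) (0%N, [::])
  else [seq (p.1, [:: Node a p.2]) | p <- plucks_with tree_plucks ts].

Definition forest_plucks : forest nat -> seq (nat * forest nat) :=
  plucks_with tree_plucks.

Arguments forest_plucks F : simpl never.

Fixpoint forest_poly_rec (n : nat) (F : forest nat) : {poly int} :=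
  if n is n'.+1 then
    \sum_(p <- forest_plucks F) 'X^(p.1) * forest_poly_rec n' (age p.2)
  else 1.

Definition forest_poly (F : forest nat) : {poly int} :=
  forest_poly_rec (size (forest_vertices F)) F.

Lemma eq_sum_all (R : nmodType) (I : Type) (s : seq I) (P : pred I)
    (f g : I -> R) :
  all P s -> (forall i, P i -> f i = g i) ->
  \sum_(i <- s) f i = \sum_(i <- s) g i.
Proof. by move=> /all_filterP <- fg; rewrite !big_filter; apply: eq_bigr. Qed.

Lemma forest_plucks_cons (t : ptree nat) (F : forest nat) :
  forest_plucks (t :: F) =
    [seq ((p.1 + size (forest_vertices F))%N, p.2 ++ F) | p <- tree_plucks t]
      ++ [seq (p.1, t :: p.2) | p <- forest_plucks F].
Proof. by []. Qed.

Lemma tree_plucks_Node (a : nat) (ts : forest nat) : ts <> [::] ->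
  tree_plucks (Node a ts) = [seq (p.1, [:: Node a p.2]) | p <- forest_plucks ts].
Proof. by case: ts. Qed.

Lemma forest_plucks_cat (F G : forest nat) :
  forest_plucks (F ++ G) =
    [seq ((p.1 + size (forest_vertices G))%N, p.2 ++ G) | p <- forest_plucks F]
      ++ [seq (p.1, F ++ p.2) | p <- forest_plucks G].
Proof.
elim: F => [|t F IH].
  by rewrite /=; elim: (forest_plucks G) => //= -[a b] s <-.
rewrite cat_cons !forest_plucks_cons IH !map_cat -!map_comp -catA.
congr (_ ++ _ ++ _); apply: eq_map => p /=.
by rewrite forest_vertices_cat size_cat addnA catA.
Qed.

(** What the induction must know about a pluck: it needs a leaf of weight 1, it
    creates no new label, so bounds on labels persist, and it removes exactly
    one vertex. *)
Lemma forest_plucks_all (F : forest nat) :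
  all (fun p : nat * forest nat => [&& 1%N \in forest_leaves F,
                    subseq (forest_vertices p.2) (forest_vertices F)
                  & (size (forest_vertices p.2)).+1 == size (forest_vertices F)])
      (forest_plucks F).
Proof.
elim/forest_ind: F => // a ts F IHts IHF.
rewrite forest_plucks_cons forest_leaves_cons forest_vertices_cons mem_cat.
rewrite all_cat !all_map; apply/andP; split; last first.
  apply: sub_all IHF => p /and3P[l1 sub /eqP sz].
  apply/and3P; rewrite l1 orbT forest_vertices_cons -!cat_cons cat_subseq //.
  by rewrite !size_cat -sz addnS.
case: ts IHts => [|t ts] IHts.
  rewrite [tree_plucks _]/= all_nseq; case: (a =P 1%N) => [->|//]; apply/and3P.
  by rewrite inE subseq_cons.
rewrite tree_plucks_Node // all_map; apply: sub_all IHts => p /and3P[l1 sub /eqP sz].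
apply/and3P; split; first by rewrite l1.
  rewrite forest_vertices_cons.
  by apply: (@cat_subseq _ (a :: _) _ (a :: _)) => //=; rewrite eqxx.
move: (forest_vertices (t :: ts)) sz => s sz.
by rewrite forest_vertices_cons /= !size_cat -sz.
Qed.

Lemma forest_vertices_map (A B : Type) (f : A -> B) (F : forest A) :
  forest_vertices (map (map_tree f) F) = map f (forest_vertices F).
Proof.
elim/forest_ind: F => // a ts F IHts IHF.
by rewrite /= !forest_vertices_cons IHts IHF /= map_cat.
Qed.

Lemma forest_leaves_map (A B : Type) (f : A -> B) (F : forest A) :
  forest_leaves (map (map_tree f) F) = map f (forest_leaves F).
Proof.
elim/forest_ind: F => // a ts F IHts IHF.
rewrite /= !forest_leaves_cons IHF map_cat; congr (_ ++ _).
by case: ts IHts.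
Qed.

Lemma forest_polyE (F : forest nat) : F <> [::] ->
  forest_poly F = \sum_(p <- forest_plucks F) 'X^(p.1) * forest_poly (age p.2).
Proof.
move=> F0; have := forest_vertices_gt0 F0; rewrite {1}/forest_poly.
case szF: (size (forest_vertices F)) => [|n] // _ /=.
apply: (eq_sum_all (forest_plucks_all F)) => p.
case/and3P => _ _; rewrite szF eqSS => /eqP <-.
by rewrite /forest_poly forest_vertices_map size_map.
Qed.

Lemma age_id (F : forest nat) : all (pred1 1%N) (forest_vertices F) -> age F = F.
Proof.
elim/forest_ind: F => // a ts F IHts IHF.
rewrite forest_vertices_cons /= all_cat => /and3P[/eqP-> /IHts + /IHF].
by rewrite /age /= => -> ->.
Qed.

(** * Forests with a hole *)

(** The hole stands between the trees l and r of a forest, or (Under l a C r)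
    somewhere above the root a of the tree that follows l. *)
Inductive context (V : Type) : Type :=
| Hole of forest V & forest V
| Under of forest V & V & context V & forest V.

Fixpoint plug (V : Type) (C : context V) (F : forest V) : forest V :=
  match C with
  | Hole l r => l ++ F ++ r
  | Under l a C' r => l ++ Node a (plug C' F) :: r
  end.

Fixpoint context_vertices (V : Type) (C : context V) : seq V :=
  match C with
  | Hole l r => forest_vertices l ++ forest_vertices r
  | Under l a C' r =>
      forest_vertices l ++ a :: context_vertices C' ++ forest_vertices r
  end.

Fixpoint context_leaves (V : Type) (C : context V) : seq V :=
  match C with
  | Hole l r => forest_leaves l ++ forest_leaves r
  | Under l a C' r => forest_leaves l ++ context_leaves C' ++ forest_leaves r
  end.

Lemma context_leaves_sub (V : eqType) (C : context V) :
  {subset context_leaves C <= context_vertices C}.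
Proof.
elim: C => [l r|l a C IH r] u; rewrite /= ?inE !mem_cat ?inE ?mem_cat.
  by case/orP => /forest_leaves_sub->; rewrite ?orbT.
by case/or3P => [/forest_leaves_sub|/IH|/forest_leaves_sub]->; rewrite ?orbT.
Qed.

Fixpoint map_context (A B : Type) (h : ptree A -> ptree B) (f : A -> B)
    (C : context A) : context B :=
  match C with
  | Hole l r => Hole (map h l) (map h r)
  | Under l a C' r => Under (map h l) (f a) (map_context h f C') (map h r)
  end.

(** How much a filling's pluck gains in exponent from the surrounding context. *)
Fixpoint context_right (V : Type) (C : context V) : nat :=
  match C with
  | Hole _ r => size (forest_vertices r)
  | Under _ _ C' r => context_right C' + size (forest_vertices r)
  end.

(** The plucks of a context at one of its own leaves, when the hole holds a
    nonempty forest with k vertices; k matters only for the exponents. *)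
Fixpoint context_plucks (k : nat) (C : context nat) : seq (nat * context nat) :=
  match C with
  | Hole l r =>
      [seq (p.1 + (k + size (forest_vertices r)), Hole p.2 r)%N | p <- forest_plucks l]
      ++ [seq (p.1, Hole l p.2) | p <- forest_plucks r]
  | Under l a C' r =>
      [seq (p.1 + (k + (size (context_vertices C') + size (forest_vertices r))).+1,
            Under p.2 a C' r)%N | p <- forest_plucks l]
      ++ [seq ((p.1 + size (forest_vertices r))%N, Under l a p.2 r)
            | p <- context_plucks k C']
      ++ [seq (p.1, Under l a C' p.2) | p <- forest_plucks r]
  end.

Lemma plug_nonempty (V : Type) (C : context V) (F : forest V) :
  F <> [::] -> plug C F <> [::].
Proof. by case: C => [[|? ?] r|[|? ?] a C r] /=; case: F. Qed.

Lemma plug_vertices (V : eqType) (C : context V) (F : forest V) :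
  perm_eq (forest_vertices (plug C F)) (context_vertices C ++ forest_vertices F).
Proof.
apply/permP => P; elim: C => [l r|l a C IH r] /=.
  by rewrite !forest_vertices_cat !count_cat; lia.
rewrite forest_vertices_cat forest_vertices_cons !count_cat /= !count_cat IH.
by rewrite count_cat; lia.
Qed.

Lemma size_plug_vertices (V : Type) (C : context V) (F : forest V) :
  size (forest_vertices (plug C F)) =
    (size (forest_vertices F) + size (context_vertices C))%N.
Proof.
elim: C => [l r|l a C IH r] /=.
  by rewrite !forest_vertices_cat !size_cat addnCA.
rewrite forest_vertices_cat forest_vertices_cons !size_cat /= !size_cat IH; lia.
Qed.

Lemma plug_leaves (V : eqType) (C : context V) (F : forest V) : F <> [::] ->
  forest_leaves (plug C F) =i context_leaves C ++ forest_leaves F.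
Proof.
move=> F0 u; elim: C => [l r|l a C IH r] /=.
  by rewrite !forest_leaves_cat !mem_cat orbAC !orbA.
rewrite forest_leaves_cat forest_leaves_cons.
have CF := plug_nonempty (C := C) F0.
have -> : (if plug C F is [::] then [:: a] else forest_leaves (plug C F)) =
    forest_leaves (plug C F) by case: (plug C F) CF.
rewrite !mem_cat IH mem_cat.
by do ![case: (u \in _)].
Qed.

Lemma plug_age (C : context nat) (F : forest nat) :
  age (plug C F) = plug (map_context (map_tree age_weight) age_weight C) (age F).
Proof. by rewrite /age; elim: C => [l r|l a C IH r] /=; rewrite !map_cat //= IH. Qed.

Lemma context_leaves_map (A B : Type) (f : A -> B) (C : context A) :
  context_leaves (map_context (map_tree f) f C) = map f (context_leaves C).
Proof. by elim: C => [l r|l a C IH r] /=; rewrite ?IH !map_cat !forest_leaves_map. Qed.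

Lemma size_context_vertices_map (A B : Type) (f : A -> B) (C : context A) :
  size (context_vertices (map_context (map_tree f) f C)) =
    size (context_vertices C).
Proof.
elim: C => [l r|l a C IH r] /=; rewrite !size_cat /= ?size_cat ?IH;
by rewrite !forest_vertices_map !size_map.
Qed.

Lemma context_plucks_all (k : nat) (C : context nat) :
  all (fun p : nat * context nat => (1%N \in context_leaves C)
             && ((size (context_vertices p.2)).+1 == size (context_vertices C)))
      (context_plucks k C).
Proof.
have P := forest_plucks_all.
elim: C => [l r|l a C IH r] /=; rewrite !all_cat !all_map.
  apply/andP; split; [apply: sub_all (P l)|apply: sub_all (P r)] => p /=;
    case/and3P => l1 _ /eqP sz; rewrite mem_cat l1 ?orbT !size_cat -sz /=; lia.
apply/and3P; split; [apply: sub_all (P l)|apply: sub_all IH|apply: sub_all (P r)] => p /=.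
- by case/and3P => l1 _ /eqP sz; rewrite mem_cat l1 ?orbT !size_cat -sz /=; lia.
- by case/andP => l1 /eqP sz; rewrite !mem_cat l1 ?orbT !size_cat /= !size_cat -sz /=; lia.
by case/and3P => l1 _ /eqP sz; rewrite !mem_cat l1 ?orbT !size_cat /= !size_cat -sz /=; lia.
Qed.

(** A leaf of a filled context is a leaf of the filling or one of the context.
    Nonemptiness of F keeps the vertex below the hole from being a leaf. *)
Lemma sum_plucks_plug (R : nmodType) (C : context nat) (F : forest nat)
    (G : nat -> forest nat -> R) : F <> [::] ->
  \sum_(p <- forest_plucks (plug C F)) G p.1 p.2 =
    \sum_(p <- forest_plucks F) G (p.1 + context_right C)%N (plug C p.2)
    + \sum_(p <- context_plucks (size (forest_vertices F)) C) G p.1 (plug p.2 F).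
Proof.
move=> F0; elim: C G => [l r|l a C IH r] G /=.
  rewrite !forest_plucks_cat !map_cat !big_cat !big_map /= addrCA.
  congr (_ + (_ + _)).
  by apply: eq_bigr => p _; rewrite forest_vertices_cat size_cat.
have CF := plug_nonempty (C := C) F0.
rewrite forest_plucks_cat.
have -> : forest_plucks (Node a (plug C F) :: r) =
    [seq ((p.1 + size (forest_vertices r))%N, Node a p.2 :: r)
       | p <- forest_plucks (plug C F)]
      ++ [seq (p.1, Node a (plug C F) :: p.2) | p <- forest_plucks r].
  by rewrite forest_plucks_cons tree_plucks_Node // -map_comp.
rewrite map_cat !big_cat !big_map /=.
rewrite (IH (fun n H => G (n + size (forest_vertices r))%N (l ++ Node a H :: r))).
rewrite -[in LHS]addrA addrCA; congr (_ + (_ + _)).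
  by apply: eq_bigr => p _; rewrite addnA.
apply: eq_bigr => p _; rewrite forest_vertices_cons /= size_cat.
by rewrite size_plug_vertices -addnA.
Qed.

(** * The factorisation for weighted forests *)

Fixpoint unit_path (n : nat) : forest nat :=
  if n is n'.+1 then [:: Node 1%N (unit_path n')] else [::].

Lemma size_unit_path (n : nat) : size (forest_vertices (unit_path n)) = n.
Proof. by elim: n => //= n IH; rewrite forest_vertices_cons cats0 /= IH. Qed.

Lemma age_unit_path (n : nat) : age (unit_path n) = unit_path n.
Proof. by rewrite /age; elim: n => //= n ->. Qed.

Lemma unit_path_plucks (n : nat) :
  forest_plucks (unit_path n.+1) = [:: (0%N, unit_path n)].
Proof.
elim: n => [|n IH] //.
rewrite [unit_path _]/= forest_plucks_cons cats0.
rewrite -[LHS]/(map _ (map _ (forest_plucks (unit_path n.+1)))).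
by rewrite IH.
Qed.

(** The threshold m separates the weights of F from those of the leaves of C.
    Bounding all labels of F, inner ones included, keeps the bound true when an
    inner vertex becomes a leaf; the labels of inner vertices of C may be
    arbitrary, because a pluck in C forces m <= 1 and ageing makes every weight
    at least 1. *)
Lemma forest_poly_plug (m : nat) (C : context nat) (F : forest nat) :
  all (fun a => 0 < a <= m)%N (forest_vertices F) ->
  all (leq m) (context_leaves C) ->
  forest_poly (plug C F) =
    forest_poly F * forest_poly (plug C (unit_path (size (forest_vertices F)))).
Proof.
have [n] := ubnP (size (forest_vertices (plug C F))).
elim: n m C F => // n IH m C [|t F0]; first by move=> _ _ _; rewrite mul1r.
have : t :: F0 <> [::] by [].
move: (t :: F0) => F {t F0} F0 le_n Fm Cm.
have PF := forest_plucks_all F; have := forest_vertices_gt0 F0.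
case szF: (size (forest_vertices F)) => [|k] // _.
set age_context := map_context (map_tree age_weight) age_weight.
have path0 : unit_path k.+1 <> [::] by [].
rewrite size_plug_vertices in le_n.
rewrite forest_polyE; last exact: plug_nonempty.
rewrite (sum_plucks_plug C (fun n G => 'X^n * forest_poly (age G)) F0).
rewrite szF (forest_polyE (plug_nonempty path0)).
rewrite (sum_plucks_plug C (fun n G => 'X^n * forest_poly (age G)) path0).
rewrite size_unit_path unit_path_plucks big_seq1 /= mulrDr; congr (_ + _).
  (* A pluck of F is paired with the only pluck of the path; the separating
     threshold ages like the weights. *)
  rewrite (forest_polyE F0) mulr_suml; apply: (eq_sum_all PF) => p.
  case/and3P => _ sub /eqP sz; rewrite !plug_age age_unit_path add0n exprD.
  have -> : forest_poly (plug (age_context C) (age p.2)) =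
      forest_poly (age p.2) * forest_poly (plug (age_context C) (unit_path k)).
    have -> : k = size (forest_vertices (age p.2)).
      by rewrite forest_vertices_map size_map; lia.
    apply: (IH (maxn 1 m.-1)).
    - by rewrite size_plug_vertices forest_vertices_map size_map
        size_context_vertices_map; lia.
    - rewrite forest_vertices_map all_map.
      apply/allP => a /(mem_subseq sub) /(allP Fm) /=; rewrite /age_weight; lia.
    rewrite context_leaves_map all_map.
    by apply: sub_all Cm => a /=; rewrite /age_weight; lia.
  by rewrite -!mulrA; congr (_ * _); rewrite mulrCA.
(* A pluck in C: all labels of F are 1, so F does not age. *)
rewrite mulr_sumr -/(unit_path k.+1).
apply: (eq_sum_all (context_plucks_all k.+1 C)) => p /andP[C1 /eqP sz].
have m1 : (m <= 1)%N by apply: (allP Cm).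
have F1 : age F = F.
  by apply: age_id; apply: sub_all Fm => a /=; lia.
rewrite mulrCA !plug_age age_unit_path F1 -szF; congr (_ * _).
apply: (IH m) => //.
  by rewrite size_plug_vertices size_context_vertices_map; lia.
rewrite context_leaves_map all_map; apply/allP => a _ /=.
by rewrite /age_weight; lia.
Qed.

(** * Plucking a named tree is plucking a weighted forest *)

(** Inner vertices get weight 1, the weight they will have if they ever become
    leaves. *)
Fixpoint weigh (V : Type) (alpha : V -> nat) (T : ptree V) : ptree nat :=
  let: Node v ts := T in
  Node (if ts is [::] then alpha v else 1%N) (map (weigh alpha) ts).

Lemma weigh_nonempty (V : Type) (alpha : V -> nat) (F : forest V) :
  F <> [::] -> map (weigh alpha) F <> [::].
Proof. by case: F. Qed.

Lemma size_weigh_vertices (V : Type) (alpha : V -> nat) (F : forest V) :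
  size (forest_vertices (map (weigh alpha) F)) = size (forest_vertices F).
Proof.
elim/forest_ind: F => // v ts F IHts IHF.
by rewrite /= !forest_vertices_cons /= !size_cat IHts IHF.
Qed.

Lemma weigh_leaves (V : Type) (alpha : V -> nat) (F : forest V) :
  forest_leaves (map (weigh alpha) F) = map alpha (forest_leaves F).
Proof.
elim/forest_ind: F => // v ts F IHts IHF.
rewrite /= !forest_leaves_cons IHF map_cat; congr (_ ++ _).
by case: ts IHts.
Qed.

Lemma all_weigh_vertices (V : eqType) (alpha : V -> nat) (P : pred nat)
    (F : forest V) :
  P 1%N -> {in forest_leaves F, forall v, P (alpha v)} ->
  all P (forest_vertices (map (weigh alpha) F)).
Proof.
move=> P1; elim/forest_ind: F => // v ts F IHts IHF PF.
rewrite /= forest_vertices_cons /= all_cat.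
have PF' u : u \in forest_leaves F -> P (alpha u).
  by move=> uF; apply: PF; rewrite forest_leaves_cons mem_cat uF orbT.
rewrite IHF // andbT; case: ts IHts PF => [|t ts] IHts PF.
  by rewrite PF // forest_leaves_cons mem_cat inE eqxx.
rewrite P1 IHts // => u uts.
by apply: PF; rewrite forest_leaves_cons mem_cat uts.
Qed.

Lemma eq_weigh (V : eqType) (alpha beta : V -> nat) (F : forest V) :
  {in forest_leaves F, alpha =1 beta} -> map (weigh alpha) F = map (weigh beta) F.
Proof.
elim/forest_ind: F => // v ts F IHts IHF ab /=.
rewrite IHF; last by move=> u uF; apply: ab; rewrite forest_leaves_cons mem_cat uF orbT.
congr (Node _ _ :: _); case: ts IHts ab => [|t ts] // IHts ab.
  by apply: ab; rewrite forest_leaves_cons inE eqxx.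
by apply: IHts => u uts; apply: ab; rewrite forest_leaves_cons mem_cat uts.
Qed.

Lemma age_weigh (V : Type) (alpha : V -> nat) (F : forest V) :
  age (map (weigh alpha) F) = map (weigh (age_weight \o alpha)) F.
Proof.
rewrite /age; elim/forest_ind: F => // v ts F IHts IHF /=.
by rewrite IHF IHts; case: ts {IHts}.
Qed.

Lemma weigh_plug (V : Type) (alpha : V -> nat) (C : context V) (F : forest V) :
  F <> [::] ->
  map (weigh alpha) (plug C F) =
    plug (map_context (weigh alpha) (fun=> 1%N) C) (map (weigh alpha) F).
Proof.
move=> F0; elim: C => [l r|l a C IH r] /=; first by rewrite !map_cat.
rewrite map_cat /= IH; congr (_ ++ Node _ _ :: _).
by case DG: (plug C F) => //; case: (plug_nonempty F0 DG).
Qed.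

Lemma weigh_context_leaves (V : Type) (alpha : V -> nat) (C : context V) :
  context_leaves (map_context (weigh alpha) (fun=> 1%N) C) =
    map alpha (context_leaves C).
Proof. by elim: C => [l r|l a C IH r] /=; rewrite ?IH !map_cat !weigh_leaves. Qed.

Lemma eq_weigh_context (V : eqType) (alpha beta : V -> nat) (C : context V) :
  {in context_leaves C, alpha =1 beta} ->
  map_context (weigh alpha) (fun=> 1%N) C = map_context (weigh beta) (fun=> 1%N) C.
Proof.
elim: C => [l r|l a C IH r] /= ab.
  by rewrite !(@eq_weigh _ alpha beta) // => u uC; apply: ab;
     rewrite mem_cat uC ?orbT.
by rewrite IH ?(@eq_weigh _ alpha beta) // => u uC; apply: ab;
   rewrite !mem_cat uC ?orbT.
Qed.

(** With distinct names, looking up a vertex by its name finds the right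
    subtree, so the degrees by which leaves are defined are the actual ones. *)
Lemma leavesE (V : eqType) (T : ptree V) :
  uniq (vertices T) -> leaves T = forest_leaves (children T).
Proof.
have lookup (P : pred V) (s : seq (ptree V)) : uniq (map (@root_of V) s) ->
    [seq v <- map (@root_of V) s | P v
        & nilp (children (head (Node v [::]) [seq t <- s | root_of t == v]))]
    = [seq root_of t | t <- s & P (root_of t) && nilp (children t)].
  elim: s => //= t s IH /andP[ts us]; rewrite eqxx /= [RHS]fun_if /= -IH //.
  congr (if _ then _ :: _ else _); apply: eq_in_filter => v vs;
    by case: eqP => // tv; rewrite tv vs in ts.
case: T => r ts uT; rewrite [children _]/=.
have -> : leaves (Node r ts) =
    [seq v <- vertices (Node r ts) | v != r & nilp (children (subtree (Node r ts) v))].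
  apply: eq_filter => v; rewrite /degree /=.
  by case: eqP => //= _; rewrite addn1 eqSS.
rewrite /subtree {1}verticesE lookup -?verticesE //= eqxx /=.
rewrite vertices_Node /= in uT; case/andP: uT => + _.
rewrite -forest_verticesE.
elim/forest_ind: ts => // v ts F IHts IHF.
rewrite forest_vertices_cons inE mem_cat !negb_or => /and3P[rv /IHts {}IHts /IHF{}IHF].
rewrite /= [v == r]eq_sym rv /= filter_cat forest_leaves_cons.
case: ts IHts => [|t ts] IHts; first by rewrite /= IHF.
by rewrite /nilp [size _ == _]/= map_cat IHts IHF.
Qed.

Lemma delete_leaf_id (V : eqType) (v : V) (F : forest V) :
  v \notin forest_vertices F ->
  map (delete_leaf v) F = F /\ [seq t <- F | root_of t != v] = F.
Proof.
elim/forest_ind: F => // a ts F IHts IHF.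
rewrite forest_vertices_cons inE mem_cat !negb_or.
case/and3P => va /IHts[dts fts] /IHF[dF fF].
by rewrite /= dts fts dF fF eq_sym va.
Qed.

Lemma right_number_cons (V : eqType) (r v : V) (t : ptree V) (F : forest V) :
  right_number (Node r (t :: F)) v =
    if v \in vertices t then (right_number t v + size (forest_vertices F))%N
    else right_number (Node r F) v.
Proof.
by rewrite /right_number /= forest_verticesE; case: ifP; rewrite ?size_cat.
Qed.

(** Plucking in a weighted forest agrees with deleting a named leaf.  The new
    weights beta are alpha on the old leaves and 1 on the old inner vertices, so
    that the leaves created by the deletion get the label they already carry. *)
Lemma forest_plucks_weigh (V : eqType) (r : V) (F : forest V) (alpha beta : V -> nat) :
  uniq (forest_vertices F) ->
  {in forest_vertices F, forall v,
     beta v = if v \in forest_leaves F then alpha v else 1%N} ->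
  forest_plucks (map (weigh alpha) F) =
    [seq (right_number (Node r F) v,
          map (weigh beta) (children (delete_leaf v (Node r F))))
       | v <- forest_leaves F & alpha v == 1%N].
Proof.
elim/forest_ind: F r => // a ts F IHts IHF r.
rewrite forest_vertices_cons cons_uniq cat_uniq mem_cat negb_or.
case/and4P => /andP[a_ts a_F] uts /hasPn ts_F uF ab.
have lF := @forest_leaves_sub _ F; have lts := @forest_leaves_sub _ ts.
have abF : {in forest_vertices F, forall v,
     beta v = if v \in forest_leaves F then alpha v else 1%N}.
  move=> v vF; rewrite ab; last by rewrite inE mem_cat vF ?orbT.
    rewrite forest_leaves_cons mem_cat.
  have := ts_F v vF; have : v != a by apply: contraNneq a_F => <-.
  case: {+}ts lts => [|t ts'] lts va vts; first by rewrite inE (negPf va).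
  by case: (boolP (v \in forest_leaves (t :: ts'))) => // /lts; rewrite (negPf vts).
have bF : map (weigh alpha) F = map (weigh beta) F.
  by apply: eq_weigh => v vF; rewrite abF ?lF // vF.
rewrite map_cons forest_plucks_cons forest_leaves_cons filter_cat map_cat.
congr (_ ++ _).
  case: ts uts a_ts ts_F ab lts IHts => [|t ts] uts a_ts ts_F ab lts IHts.
    have [dF fF] := delete_leaf_id a_F.
    rewrite /=; case: eqP => //= _.
    by rewrite right_number_cons vertices_Node mem_head eqxx dF fF bF
      size_weigh_vertices.
  have abts : {in forest_vertices (t :: ts), forall v,
     beta v = if v \in forest_leaves (t :: ts) then alpha v else 1%N}.
    move=> v vts; rewrite ab; last by rewrite inE mem_cat vts ?orbT.
    rewrite forest_leaves_cons mem_cat.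
    case: (boolP (v \in forest_leaves F)) => [/lF/ts_F|]; last by rewrite orbF.
    by rewrite /= vts.
  have ba : beta a = 1%N.
    rewrite ab ?mem_head // forest_leaves_cons mem_cat.
    case: ifP => // /orP[/lts|/lF]; first by rewrite (negPf a_ts).
    by rewrite (negPf a_F).
  rewrite [weigh _ _]/= -[_ :: _]/(map (weigh alpha) (t :: ts)).
  rewrite tree_plucks_Node // (IHts a uts abts) -!map_comp; apply/eq_in_map => v.
  rewrite mem_filter => /andP[_ /lts vts].
  have va : a != v by apply: contraNneq a_ts => ->.
  have vF : v \notin forest_vertices F by apply/negP => /ts_F; rewrite /= vts.
  have [dF fF] := delete_leaf_id vF.
  rewrite right_number_cons vertices_Node inE eq_sym (negPf va) -forest_verticesE vts.
  rewrite /= va dF fF size_weigh_vertices bF /= ba.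
  by congr (_, Node _ _ :: _); case: (if _ then _ else _).
rewrite (IHF r uF abF) -map_comp; apply/eq_in_map => v.
rewrite mem_filter => /andP[_ /lF vF].
have va : a != v by apply: contraNneq a_F => ->.
have vts := ts_F v vF.
have [dts fts] := delete_leaf_id vts.
rewrite right_number_cons vertices_Node inE eq_sym (negPf va) -forest_verticesE.
rewrite (negPf vts) /= va dts fts /=; congr (_, Node _ _ :: _).
  case: ts {uts a_ts ts_F vts IHts lts dts fts} ab => // ab.
  by rewrite ab ?mem_head // forest_leaves_cons inE eqxx.
case: ts uts a_ts ts_F ab lts {IHts vts dts fts} => // t ts uts a_ts ts_F ab lts.
apply: eq_weigh => u uts'; rewrite ab; last by rewrite inE mem_cat lts ?orbT.
by rewrite forest_leaves_cons mem_cat uts'.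
Qed.

Lemma delete_leaf_subseq (V : eqType) (v : V) (F : forest V) :
  subseq (forest_vertices [seq t <- map (delete_leaf v) F | root_of t != v])
         (forest_vertices F).
Proof.
elim/forest_ind: F => // a ts F IHts IHF /=.
rewrite forest_vertices_cons; case: eqP => _ /=.
  by apply: subseq_trans (subseq_cons _ _); apply: subseq_trans IHF (suffix_subseq _ _).
by rewrite forest_vertices_cons /= eqxx cat_subseq.
Qed.

(** The weights of a plucked tree are those of [forest_plucks_weigh] aged by one
    step, hence the two recurrences coincide. *)
Lemma plucking_poly_weigh (V : eqType) (T : ptree V) (alpha : V -> nat) :
  uniq (vertices T) ->
  plucking_poly T alpha = forest_poly (map (weigh alpha) (children T)).
Proof.
have [n] := ubnP (num_edges T); elim: n T alpha => // n IH [r F] alpha le_n uT.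
rewrite plucking_polyE {1}/num_edges vertices_Node /= -forest_verticesE.
case: F le_n uT => // t F le_n uT; have F0 : t :: F <> [::] by [].
move: (t :: F) F0 le_n uT => {t}F F0 le_n uT.
have -> : (size (forest_vertices F) == 0%N) = false.
  by have := forest_vertices_gt0 F0; lia.
pose beta v := if v \in leaves (Node r F) then alpha v else 1%N.
have uF : uniq (forest_vertices F) by move: uT; rewrite vertices_Node => /andP[].
have lE := leavesE uT.
rewrite (forest_polyE (@weigh_nonempty _ alpha _ F0)).
rewrite (@forest_plucks_weigh _ r _ alpha beta) //; last by rewrite /beta lE.
rewrite big_map /leaves1 lE; apply: eq_big_seq => v; rewrite mem_filter => /andP[_ vF].
have lt_v : (num_edges (delete_leaf v (Node r F)) < num_edges (Node r F))%N.
  by apply: num_edges_delete_leaf; rewrite lE.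
congr (_ * _); rewrite IH.
- rewrite age_weigh; congr forest_poly; apply: eq_weigh => u _.
  by rewrite /plucked_weight /= /beta; case: ifP.
- exact: leq_trans lt_v le_n.
apply: subseq_uniq uT; rewrite /= !vertices_Node -!forest_verticesE /= eqxx.
exact: delete_leaf_subseq.
Qed.

(** * A subtree and its replacement as fillings of one context *)

Lemma replace_subtree_id (V : eqType) (v : V) (S : ptree V) (F : forest V) :
  v \notin forest_vertices F -> map (replace_subtree v S) F = F.
Proof.
elim/forest_ind: F => // a ts F IHts IHF.
rewrite forest_vertices_cons inE mem_cat !negb_or => /and3P[va /IHts dts /IHF dF].
by rewrite /= dF dts eq_sym (negPf va).
Qed.

Lemma filter_subtrees_nil (V : eqType) (v : V) (F : forest V) :
  v \notin forest_vertices F ->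
  [seq t <- flatten (map (@subtrees V) F) | root_of t == v] = [::].
Proof.
elim/forest_ind: F => // a ts F IHts IHF.
rewrite forest_vertices_cons inE mem_cat !negb_or => /and3P[va /IHts dts /IHF dF].
by rewrite /= eq_sym (negPf va) filter_cat dF dts.
Qed.

(** Distinct names make v occur once, so replacing the subtree at v by name
    changes only the filling of the hole. *)
Lemma forest_context (V : eqType) (v : V) (l ts r F : forest V) :
  uniq (forest_vertices F) -> v \in forest_vertices F ->
  head (Node v [::]) [seq t <- flatten (map (@subtrees V) F) | root_of t == v]
    = Node v (l ++ ts ++ r) ->
  exists C : context V, [/\ v \in context_vertices C, F = plug C ts &
    forall ss, map (replace_subtree v (Node v (l ++ ss ++ r))) F = plug C ss].
Proof.
elim/forest_ind: F => // a cs F IHcs IHF.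
rewrite forest_vertices_cons cons_uniq cat_uniq mem_cat negb_or.
case/and4P => /andP[a_cs a_F] ucs /hasPn cs_F uF; rewrite inE mem_cat /=.
case: (eqVneq v a) a_F => [<- v_F _ [->]|va _].
  exists (Under [::] v (Hole l r) F); split=> [||ss] //=; first exact: mem_head.
  by rewrite replace_subtree_id.
rewrite filter_cat; case: (boolP (v \in forest_vertices F)) => [vF _|vF].
  have vcs := cs_F v vF.
  rewrite filter_subtrees_nil //= => /(IHF uF vF)[C [vC EF RF]].
  have rcs S : map (replace_subtree v S) cs = cs by apply: replace_subtree_id.
  case: C vC EF RF => [l' r'|l' b C r'] /= vC EF RF.
    exists (Hole (Node a cs :: l') r').
    by split=> [||ss] /=; rewrite ?rcs ?RF ?EF // forest_vertices_cons /= inE -catA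
      mem_cat vC !orbT.
  exists (Under (Node a cs :: l') b C r').
  by split=> [||ss] /=; rewrite ?rcs ?RF ?EF // forest_vertices_cons /= inE -catA
    mem_cat vC !orbT.
rewrite orbF (filter_subtrees_nil vF) cats0 => vcs.
move=> /(IHcs ucs vcs)[C [vC EC RC]].
exists (Under [::] a C F); split=> [||ss] /=; first by rewrite inE mem_cat vC orbT.
  by rewrite -EC.
by rewrite RC replace_subtree_id.
Qed.

Lemma tree_context (V : eqType) (T : ptree V) (v : V) (l ts r : forest V) :
  uniq (vertices T) -> v \in vertices T -> subtree T v = Node v (l ++ ts ++ r) ->
  exists C : context V,
    [/\ v \in root_of T :: context_vertices C, children T = plug C ts &
      forall ss,
        replace_subtree v (Node v (l ++ ss ++ r)) T = Node (root_of T) (plug C ss)].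
Proof.
case: T => u F; rewrite vertices_Node -forest_verticesE inE /subtree /=.
case: (eqVneq v u) => [<- _ _ [->]|vu /andP[_ uF] vF FE].
  by exists (Hole l r); split=> //; apply: mem_head.
have [C [vC EC RC]] := forest_context uF vF FE; exists C; split=> // [|ss].
  by rewrite inE vC orbT.
by rewrite RC.
Qed.

Lemma path_tree_vertices (V : Type) (v : V) (s : seq V) :
  forest_vertices (children (path_tree v s)) = s.
Proof.
elim: s v => //= x s IH v.
have -> : path_tree x s = Node x (children (path_tree x s)) by case: s {IH}.
by rewrite forest_vertices_cons IH cats0.
Qed.

Lemma weigh_path_tree (V : eqType) (alpha : V -> nat) (v : V) (s : seq V) :
  {in forest_leaves (children (path_tree v s)), forall u, alpha u = 1%N} ->
  map (weigh alpha) (children (path_tree v s)) = unit_path (size s).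
Proof.
move=> /(@eq_weigh _ alpha (fun=> 1%N)) ->.
elim: s v => //= x s IH v; rewrite -(IH x).
by case: s {IH}.
Qed.

Theorem theorem3p5 (V : eqType) (T T' T'' : ptree V)
    (alpha alpha' alpha'' : V -> nat) :
  uniq (vertices T) ->
  weight_function T alpha ->
  splitting_subtree T alpha T' alpha' ->
  complementary_tree T alpha T' T'' alpha'' ->
  plucking_poly T alpha = plucking_poly T' alpha' * plucking_poly T'' alpha''.
Proof.
case: T T' => r F [v ts] uT wT [/= vT _ eqa' lea].
case=> Tl [Tr [s [[/= rl _ defT] [szs us sT] -> {T''} eqa'']]].
have {}defT : subtree (Node r F) v = Node v (children Tl ++ ts ++ children Tr).
  by rewrite defT /rooted_sum /= rl catA.
have [C [/= vC defF RC]] := tree_context uT vT defT.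
move: eqa''; rewrite /rooted_sum [root_of _]/= rl [children (Node _ _)]/= -catA.
rewrite RC => {RC rl defT vT}; set P := children (path_tree v s) => eqa''.
have PE : forest_vertices P = s := path_tree_vertices v s.
have szP : size s = size (forest_vertices ts).
  by rewrite szs vertices_Node -forest_verticesE.
have uniq_plug G : uniq (vertices (Node r (plug C G))) =
    uniq ((r :: context_vertices C) ++ forest_vertices G).
  rewrite vertices_Node -forest_verticesE /= (perm_uniq (plug_vertices C G)).
  by rewrite (perm_mem (plug_vertices C G)).
have mem_plug G : vertices (Node r (plug C G)) =i
    (r :: context_vertices C) ++ forest_vertices G.
  move=> u; rewrite vertices_Node -forest_verticesE !inE.
  by rewrite (perm_mem (plug_vertices C G)).
subst F; have := uT; rewrite uniq_plug cat_uniq => /and3P[uC /hasPn tsC uts].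
have uT' : uniq (vertices (Node v ts)).
  rewrite vertices_Node -forest_verticesE /= uts andbT.
  by apply/negP => /tsC; rewrite /= vC.
have uT'' : uniq (vertices (Node r (plug C P))).
  rewrite uniq_plug cat_uniq uC PE us andbT /=; apply/hasPn => u /sT.
  by rewrite mem_plug mem_cat negb_or => /andP[].
have lT := leavesE uT; have lT' := leavesE uT'; have lT'' := leavesE uT''.
rewrite !plucking_poly_weigh //=.
rewrite lT' /= in eqa' lea *; rewrite lT'' lT /= in eqa''.
rewrite /weight_function lT /= in wT; rewrite lT /= in lea.
(* If T' has no edge, nothing is replaced; this is set apart since v may
   then be a leaf of T. *)
have [ts0|ts0] : ts = [::] \/ ts <> [::] by case: (ts); [left|right].
  have s0 : s = [::] by apply: size0nil; rewrite szP ts0.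
  have Pts : P = ts by rewrite /P s0 ts0.
  have -> : forest_poly (map (weigh alpha') ts) = 1 by rewrite ts0.
  rewrite mul1r Pts; congr forest_poly.
  by apply: eq_weigh => u uF; rewrite eqa'' ?Pts ?uF.
have P0 : P <> [::].
  move=> P0; have := forest_vertices_gt0 ts0; rewrite -szP -PE P0.
  by rewrite forest_verticesE.
have lF := plug_leaves C ts0; have lP := plug_leaves C P0.
have alpha''C : {in context_leaves C, alpha'' =1 alpha}.
  by move=> u uL; rewrite eqa'' ?lF ?lP mem_cat uL.
have alpha''P : {in forest_leaves P, forall u, alpha'' u = 1%N}.
  move=> u uP; rewrite eqa'' ?lP ?mem_cat ?uP ?orbT //.
  have /sT : u \in s by rewrite -PE forest_leaves_sub.
  rewrite vertices_Node -forest_verticesE inE negb_or => /andP[_].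
  by case: ifP => // /forest_leaves_sub ->.
rewrite !weigh_plug // (eq_weigh_context alpha''C) (weigh_path_tree alpha''P).
rewrite (eq_weigh eqa') szP -(size_weigh_vertices alpha).
(* The 1 accounts for the labels of the inner vertices of T'. *)
pose m := maxn 1 (\max_(u <- forest_leaves ts) alpha u).
apply: (@forest_poly_plug m).
  apply: all_weigh_vertices => [|u uts']; first by rewrite /m; lia.
  rewrite wT ?lF ?mem_cat ?uts' ?orbT //= /m leq_max.
  by rewrite (leq_bigmax_seq _ uts') ?orbT.
rewrite weigh_context_leaves all_map; apply/allP => u uL /=.
have uF : u \in forest_leaves (plug C ts) by rewrite lF mem_cat uL.
rewrite /m geq_max wT //=; apply/bigmax_leqP_seq => w wts _.
rewrite -eqa' // lea //; apply/negP => /forest_leaves_sub/tsC/negP[].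
by rewrite inE context_leaves_sub ?orbT.
Qed.
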